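(* For any finite set $F$ of positive integers there is an infinite subset $N$ of $2\mathbb{N}$ (the set of even positive integers) such that for each $d\in N$ there exist infinitely many Salem numbers $\alpha$ of degree $d$ having the property that $\alpha^{n}-1$ is a unit for all $n\in F$.
   Context: A Salem number is a real algebraic integer greater than $1$ whose other conjugates all lie in the closed unit disc, with at least one conjugate lying on the unit circle. Conjugates and degree are taken over $\mathbb{Q}$. A unit is an algebraic integer whose inverse is also an algebraic integer (equivalently, an algebraic integer of norm $\pm 1$ over $\mathbb{Q}$). *)

(* Defs.v *)
From mathcomp Require Import all_boot all_order all_algebra all_field.
From mathcomp Require Import classical_sets functions cardinality.

Set Implicit Arguments.
Unset Strict Implicit.
Unset Printing Implicit Defensive.

Import Order.TTheory GRing.Theory Num.Theory.
Local Open Scope ring_scope.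

(* minCpoly x is separable, so its roots in algC are exactly the conjugates
   of x over the rationals (x included). *)
Definition conjugate (x z : algC) : Prop := root (minCpoly x) z.

Definition alg_degree (x : algC) : nat := (size (minCpoly x)).-1.

Definition salem (a : algC) : Prop :=
  [/\ a \in Aint,
      a \is Num.real,
      1 < a,
      (forall z, conjugate a z -> z != a -> `|z| <= 1)
    & (exists2 z, conjugate a z & `|z| = 1)].

(* The condition x != 0 is needed because 0^-1 = 0 in algC. *)
Definition alg_unit (x : algC) : Prop :=
  [/\ x \in Aint, x != 0 & x^-1 \in Aint].

(* Main.v *)
Require Import Defs.
From mathcomp Require Import all_boot all_order all_algebra all_field.
From mathcomp Require Import classical_sets functions cardinality.
From mathcomp Require Import boolp polyrcf ring lra zify.

(* Let m be odd with m + 1 divisible by every n in F, and let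
   A(x) = (x^(m+1) - 1) (x^m - 1) (x + 1).  Since gcd(m, m+1) = 1,
   A(x) = x^(m+1) Q(x + 1/x) where Q is monic of even degree m + 1 with simple
   roots, all in [-2, 2], and with Q(2) = Q(-2) = 0.  For a large integer a put
     T(y) = Q(y) (y - a) - 1,
     S(x) = x^(m+2) T(x + 1/x) = (x^2 - a x + 1) A(x) - x^(m+2).
   Near each root of Q the polynomial T changes sign, and T(2) = T(-2) = -1
   keeps the corresponding root inside (-2, 2); the remaining root of T exceeds
   2.  So S has a real root al > 1, the root 1/al, and all its other roots lie on
   the unit circle.  If S = g P with P the minimal polynomial of al, the product
   of z^2 - a z + 1 over the roots z of g is a unit of Z because S = - x^(m+2)
   modulo x^2 - a x + 1; but each factor has modulus > 1 when |z| = 1, so g = 1.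
   Finally al^n - 1 divides A(al), which divides the unit al^(m+2). *)

Set Implicit Arguments.
Unset Strict Implicit.
Unset Printing Implicit Defensive.

Import Order.TTheory GRing.Theory Num.Theory.
Local Open Scope classical_set_scope.
Local Open Scope ring_scope.

(** * Perturbing a split real polynomial *)

Lemma seq_pos_lb (R : realFieldType) (s : seq R) :
  all (fun x => 0 < x) s -> exists2 e : R, 0 < e & all (fun x => e < x) s.
Proof.
elim: s => [|x s IHs] /=; first by exists 1.
case/andP=> x_gt0 /IHs[e e_gt0 lt_e]; exists (Num.min e (x / 2)).
  by rewrite lt_min e_gt0 divr_gt0.
rewrite gt_min [x / 2 < x]gtr_pMr // invf_lt1 // ltr1n orbT /=.
by apply: sub_all lt_e => z ltz; rewrite gt_min ltz.
Qed.

(** The bound is [e + e] so that intervals of radius [e] around distinct points are disjoint. *)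
Lemma seq_separation (R : realFieldType) (rs : seq R) :
  exists2 e : R, 0 < e &
    {in rs &, forall r s, r != s -> e + e < `|r - s|}.
Proof.
have [|e e_gt0 /allP lt_e] := @seq_pos_lb R
    [seq `|p.1 - p.2| | p <- [seq (r, s) | r <- rs, s <- rs] & p.1 != p.2].
  apply/allP=> _ /mapP[p p_in ->]; move: p_in; rewrite mem_filter => /andP[ne_p _].
  by rewrite normr_gt0 subr_eq0.
exists (e / 2) => [|r s rs_r rs_s ne_rs]; first by rewrite divr_gt0.
rewrite -splitr; apply: lt_e; apply/mapP; exists (r, s) => //.
by rewrite mem_filter ne_rs allpairs_f.
Qed.

(** The factor at [r] takes the values [- e] and [e]; every other factor keeps its sign because [s]
    is more than [e + e] away from [r]. *)
Lemma prod_XsubC_sign_change (R : realFieldType) (rs : seq R) e r :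
    uniq rs -> 0 < e ->
    {in rs &, forall r s, r != s -> e + e < `|r - s|} -> r \in rs ->
  (\prod_(s <- rs) ('X - s%:P)).[r - e] *
    (\prod_(s <- rs) ('X - s%:P)).[r + e] < 0.
Proof.
move=> Urs e_gt0 sep_e rs_r; rewrite (big_rem r) //= !hornerM !hornerXsubC.
set P := \prod_(s <- _) _.
suffices: 0 < P.[r - e] * P.[r + e].
  move=> PP; rewrite [X in X < 0](_ : _ = - (e * e * (P.[r - e] * P.[r + e]))).
    by rewrite oppr_lt0 mulr_gt0 // mulr_gt0.
  by ring.
rewrite /P !horner_prod -big_split /= big_seq.
apply: prodr_gt0 => s; rewrite (mem_rem_uniq _ Urs) inE => /andP[ne_sr rs_s].
rewrite !hornerXsubC.
have := sep_e r s rs_r rs_s; rewrite eq_sym ne_sr => /(_ isT).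
have [le0|lt0] := ger0P (r - s); nra.
Qed.

(** For large [a] the perturbed polynomial [T] has sign opposite to [Q] at each [r - e] and [r + e],
    so it has a root near each [r]. One more root lies beyond 2, and the degree leaves room for no
    others. *)
Lemma perturbed_roots (R : rcfType) (rs : seq R) :
    uniq rs -> ~~ odd (size rs) -> 2 \in rs -> - 2 \in rs ->
    {in rs, forall r, -2 <= r <= 2} ->
  exists a0 : R, forall a, a0 <= a -> exists y0 ys,
    [/\ 2 < y0, {in ys, forall y, -2 < y < 2}, size ys = size rs
      & \prod_(r <- rs) ('X - r%:P) * ('X - a%:P) - 1
        = \prod_(y <- y0 :: ys) ('X - y%:P)].
Proof.
move=> Urs ev_rs rs2 rsN2 rs_le2.
have [e e_gt0 sep_e] := seq_separation rs.
set Q := \prod_(r <- rs) _.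
have signQ r : r \in rs -> Q.[r - e] * Q.[r + e] < 0.
  exact: prod_XsubC_sign_change.
have [|c c_gt0 /allP lt_c] := @seq_pos_lb R
    ([seq `|Q.[r - e]| | r <- rs] ++ [seq `|Q.[r + e]| | r <- rs]).
  rewrite all_cat; apply/andP; split; apply/allP=> _ /mapP[r rs_r ->].
    rewrite normr_gt0; apply: contraTneq (signQ r rs_r) => ->.
    by rewrite mul0r ltxx.
  rewrite normr_gt0; apply: contraTneq (signQ r rs_r) => ->.
  by rewrite mulr0 ltxx.
have lb_m r : r \in rs -> c < `|Q.[r - e]|.
  by move=> rs_r; apply: lt_c; rewrite mem_cat (map_f (fun r => `|Q.[r - e]|)).
have lb_p r : r \in rs -> c < `|Q.[r + e]|.
  by move=> rs_r; apply: lt_c; rewrite mem_cat (map_f (fun r => `|Q.[r + e]|)) ?orbT.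
(* For [t <= 2 + e] this gives [a - t >= c^-1], so [Q.[t] * (t - a)] outweighs the [- 1] wherever
   [Q.[t]] exceeds [c] in absolute value. *)
exists (2 + e + c^-1) => a a_big.
have ci_gt0 : 0 < c^-1 by rewrite invr_gt0.
set T := Q * _ - 1.
have TE t : T.[t] = Q.[t] * (t - a) - 1.
  by rewrite /T !hornerE.
have T2 r : r \in rs -> T.[r] = -1.
  move=> rs_r; rewrite TE; suffices /rootP->: root Q r by rewrite mul0r sub0r.
  by rewrite root_prod_XsubC.
have signT t : t <= 2 + e -> c < `|Q.[t]| -> T.[t] * Q.[t] < 0.
  move=> t_le; rewrite TE; have at_ge: c^-1 <= a - t by lra.
  have := divff (lt0r_neq0 c_gt0); move: (c^-1) at_ge ci_gt0 => d at_ge d_gt0 cd.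
  have [Q_ge0|Q_lt0] := ger0P Q.[t] => cQ.
    have: 0 <= Q.[t] * (a - t) by apply: mulr_ge0; lra.
    by have: 0 < Q.[t]; [lra|nra].
  have h1: 1 < - Q.[t] * (a - t).
    rewrite -cd; apply: lt_le_trans (_ : - Q.[t] * d <= _).
      by rewrite ltr_pM2r.
    by rewrite ler_pM2l //; lra.
  by nra.
have pm r : r \in rs -> T.[r - e] * T.[r + e] < 0.
  move=> rs_r; have /andP[_ r2] := rs_le2 r rs_r.
  have h1 := signT (r - e) ltac:(lra) (lb_m r rs_r).
  have h2 := signT (r + e) ltac:(lra) (lb_p r rs_r).
  have := signQ r rs_r.
  move: (T.[_]) (T.[_]) (Q.[_]) (Q.[_]) h1 h2 => t1 t2 q1 q2 h1 h2 h3.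
  rewrite ltNge; apply/negP=> h4.
  have: 0 < (t1 * q1) * (t2 * q2) by rewrite nmulr_rgt0.
  rewrite mulrACA => h5.
  by have: (t1 * t2) * (q1 * q2) <= 0; [apply: mulr_ge0_le0 => //; lra | lra].
(* Since [Q] is positive just outside [-2, 2], [signQ] makes it negative, and [T] positive, just
   inside both end points. On the left the positivity comes from the even number of factors. *)
have Q2e : 0 < Q.[2 + e].
  rewrite /Q horner_prod big_seq; apply: prodr_gt0 => r /rs_le2.
  by rewrite hornerXsubC; lra.
have QN2e : 0 < Q.[- 2 - e].
  rewrite /Q horner_prod.
  rewrite (eq_bigr (fun r => -1 * (r + 2 + e))); last first.
    by move=> r _; rewrite hornerXsubC; lra.
  rewrite big_split /= big_const_seq count_predT iter_mulr_1 -signr_odd.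
  rewrite (negbTE ev_rs) mul1r.
  by rewrite big_seq; apply: prodr_gt0 => r /rs_le2; lra.
have e_lt2 : e < 2.
  have := sep_e 2 (- 2) rs2 rsN2; rewrite ger0_norm; last by lra.
  have ne2 : 2 != - 2 :> R by apply/eqP; lra.
  by move/(_ ne2); lra.
have root_near r : r \in rs ->
    exists y, (root T y) && [&& -2 < y, y < 2 & `|y - r| < e].
  move=> rs_r; have pm_r := pm r rs_r; have r_le2 := rs_le2 r rs_r.
  (* At the end points 2 and -2 only the inner half of the interval is searched: [T] is -1 at the
     end point itself, and the root found cannot leave (-2, 2). *)
  have [r2|ne_r2] := eqVneq r 2.
    have [] := @poly_ivtoo _ T (2 - e) 2 ltac:(lra).
      rewrite (T2 2 rs2) mulrN1 oppr_lt0.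
      have := signT (2 - e) ltac:(lra) (lb_m 2 rs2).
      have := signQ 2 rs2; rewrite pmulr_llt0 // => Qlt0.
      by rewrite nmulr_llt0.
    move=> y; rewrite in_itv /= => /andP[y1 y2] rTy; exists y.
    by rewrite rTy y2 r2 ltr_distl; apply/and3P; split; lra.
  have [rN2|ne_rN2] := eqVneq r (- 2).
    have [] := @poly_ivtoo _ T (- 2) (- 2 + e) ltac:(lra).
      rewrite (T2 _ rsN2) mulN1r oppr_lt0.
      have := signT (- 2 + e) ltac:(lra) (lb_p _ rsN2).
      have := signQ _ rsN2; rewrite pmulr_rlt0 // => Qlt0.
      by rewrite nmulr_llt0.
    move=> y; rewrite in_itv /= => /andP[y1 y2] rTy; exists y.
    by rewrite rTy y1 rN2 ltr_distl; apply/and3P; split; lra.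
  have [] := @poly_ivtoo _ T (r - e) (r + e) ltac:(lra) pm_r.
  move=> y; rewrite in_itv /= => /andP[y1 y2] rTy; exists y.
  have /andP[r_ge r_le] := r_le2.
  have := sep_e 2 r rs2 rs_r; rewrite eq_sym ne_r2 => /(_ isT).
  rewrite ger0_norm; last by lra.
  have := sep_e r (- 2) rs_r rsN2; rewrite ne_rN2 => /(_ isT).
  rewrite ger0_norm; last by lra.
  by move=> s1 s2; rewrite rTy ltr_distl; apply/and4P; split; lra.
(* The boolean implication makes the predicate satisfiable for every [r], so [xchoose] gives a total
   function. *)
have near_ex r : exists y, (r \in rs) ==>
    (root T y) && [&& -2 < y, y < 2 & `|y - r| < e].
  case rs_r: (r \in rs); last by exists 0.
  by have [y Py] := root_near r rs_r; exists y.
pose f r := xchoose (near_ex r).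
have fP r : r \in rs -> [/\ root T (f r), -2 < f r < 2 & `|f r - r| < e].
  move=> rs_r; have := xchooseP (near_ex r).
  by rewrite -/(f r) rs_r /= => /and4P[-> -> -> ->].
have a_gt2 : 2 < a by lra.
have prod_ge1 : 1 <= (\prod_(r <- rem 2 rs) ('X - r%:P)).[a + 1].
  rewrite horner_prod big_seq.
  apply: (big_ind (fun x => 1 <= x)) => // [x y|r /mem_rem/rs_le2]; last first.
    by rewrite hornerXsubC; lra.
  exact: mulr_ege1.
(* At [a + 1] the last factor is 1, so it is enough that [Q.[a + 1] > 1]; its factor at the root 2
   is already [a - 1]. *)
have Ta : 0 < T.[a + 1].
  rewrite TE subr_gt0 [a + 1 - a](_ : _ = 1); last by ring.
  rewrite mulr1 /Q (big_rem 2) //= hornerM hornerXsubC.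
  by apply: lt_le_trans (_ : a + 1 - 2 <= _); [lra | rewrite ler_peMr //; lra].
have [|y0] := @poly_ivtoo _ T 2 (a + 1) ltac:(lra).
  by rewrite (T2 2 rs2) mulN1r oppr_lt0.
rewrite in_itv /= => /andP[y0_gt2 _] rTy0.
have f_bound : {in map f rs, forall y, -2 < y < 2}.
  by move=> _ /mapP[r /fP[_ + _] ->].
exists y0, (map f rs); split=> //; first by rewrite size_map.
have szQ : size Q = (size rs).+1 by rewrite size_prod_XsubC.
have Q_monic : Q \is monic by apply: monic_prod_XsubC.
have szQa : size (Q * ('X - a%:P)) = (size rs).+2.
  by rewrite size_Mmonic ?monicXsubC ?monic_neq0 // szQ size_XsubC addn2.
have lt_sz : (size (-1 : {poly R})%R < size (Q * ('X - a%:P))%R)%N.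
  by rewrite szQa size_polyN size_poly1.
have T_monic : T \is monic.
  by rewrite monicE lead_coefDl // lead_coef_Mmonic ?monicXsubC // -monicE.
rewrite {1}(@all_roots_prod_XsubC _ T (y0 :: map f rs)).
- by rewrite (monicP T_monic) scale1r.
- by rewrite /T size_polyDl // szQa /= size_map.
- by rewrite /= rTy0; apply/allP=> _ /mapP[r /fP[+ _ _] ->].
rewrite uniq_rootsE /=; apply/andP; split.
  by apply/negP=> /f_bound; lra.
(* A common value of [f] would put [r] and [s] within [e + e] of each other. *)
rewrite map_inj_in_uniq // => r s rs_r rs_s eq_f.
have [//|/(sep_e r s rs_r rs_s)] := eqVneq r s.
have [_ _] := fP r rs_r; have [_ _] := fP s rs_s.
rewrite eq_f; have: `|r - s| <= `|f s - s| + `|f s - r|.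
  by rewrite [`|f s - r|]distrC [leRHS]addrC; apply: ler_distD.
lra.
Qed.

(** * The polynomials [Q] and [A] *)

Lemma add_inv_surj (y : algC) : exists2 z, z != 0 & z + z^-1 = y.
Proof.
have sz : size ('X^2 - (y *: 'X - 1) : {poly algC}) = 3.
  rewrite size_polyDl size_polyXn // size_polyN.
  apply: (leq_ltn_trans (size_polyD _ _)); rewrite gtn_max size_polyN size_poly1.
  by rewrite andbT; apply: leq_ltn_trans (size_scale_leq _ _) _; rewrite size_polyX.
have [|z] := closed_rootP ('X^2 - (y *: 'X - 1) : {poly algC}) _.
  by rewrite sz.
rewrite rootE !hornerE => /eqP z_root.
have nz_z : z != 0.
  by apply: contra_eq_neq z_root => ->; rewrite expr0n mulr0 !sub0r opprK oner_neq0.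
exists z => //; apply: (mulIf nz_z); rewrite mulrDl mulVf // -[RHS]addr0 -z_root.
by ring.
Qed.

Lemma add_inv_inj (F : fieldType) (z w : F) : z != 0 -> w != 0 ->
  z + z^-1 = w + w^-1 -> z = w \/ z = w^-1.
Proof.
move=> nz_z nz_w eq_zw.
have: (z - w) * (z - w^-1) = 0.
  transitivity (z * ((z + z^-1) - (w + w^-1))); first by field; rewrite ?nz_z ?nz_w.
  by rewrite eq_zw subrr mulr0.
by move/eqP; rewrite mulf_eq0 !subr_eq0 => /orP[/eqP|/eqP]; [left|right].
Qed.

(* The Chebyshev polynomials normalised so that C_m(z + 1/z) = z^m + 1/z^m. *)
Fixpoint cheb (R : nzRingType) (m : nat) : {poly R} :=
  match m with
  | 0 => 2%:P
  | 1 => 'X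
  | (m'.+1 as m1).+1 => 'X * cheb R m1 - cheb R m'
  end.

Lemma chebSS (R : nzRingType) m :
  cheb R m.+2 = 'X * cheb R m.+1 - cheb R m.
Proof. by []. Qed.

Lemma nat_ind2 (P : nat -> Prop) :
  P 0 -> P 1 -> (forall m, P m -> P m.+1 -> P m.+2) -> forall m, P m.
Proof.
move=> P0 P1 PS m; suffices: P m /\ P m.+1 by case.
by elim: m => [|m [Pm Pm1]]; split=> //; apply: PS.
Qed.

(** Indices start at one because [cheb R 0] is the constant 2. *)
Lemma cheb_monic_size (R : nzRingType) m :
  cheb R m.+1 \is monic /\ size (cheb R m.+1) = m.+2.
Proof.
elim/nat_ind2: m => [||m [mon1 sz1] [mon2 sz2]].
- by rewrite monicX size_polyX.
- rewrite chebSS /=.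
  have lt_sz: (size (- 2%:P : {poly R}) < size ('X * 'X : {poly R})%R)%N.
    rewrite size_polyN -expr2 size_polyXn.
    exact: leq_ltn_trans (size_polyC_leq1 _) _.
  rewrite monicE lead_coefDl // size_polyDl // -expr2 lead_coefXn size_polyXn.
  by rewrite eqxx.
rewrite chebSS -commr_polyX.
have szX: size (cheb R m.+2 * 'X) = m.+4 by rewrite size_mulX ?monic_neq0 ?sz2.
have lt_sz: (size (- cheb R m.+1) < size (cheb R m.+2 * 'X)%R)%N.
  by rewrite szX size_polyN sz1.
by rewrite monicE lead_coefDl // size_polyDl // szX lead_coefMX -monicE.
Qed.

Lemma horner_cheb (F : fieldType) m (z : F) : z != 0 ->
  (cheb F m).[z + z^-1] = z ^+ m + z ^- m.
Proof.
move=> nz_z; elim/nat_ind2: m => [||m IH1 IH2].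
- by rewrite /= hornerC !expr0 invr1.
- by rewrite /= hornerX.
rewrite chebSS !hornerE IH1 IH2 !exprS; field.
by rewrite nz_z expf_neq0.
Qed.

(** This is the chain rule applied to [C_m(z + 1/z)], multiplied by [z]. It says nothing when
    [z = z^-1], so the points [2 * e] with [e ^+ 2 = 1] are treated separately. *)
Lemma horner_deriv_cheb (F : fieldType) m (z : F) : z != 0 ->
  (cheb F m)^`().[z + z^-1] * (z - z^-1) = m%:R * (z ^+ m - z ^- m).
Proof.
move=> nz_z; elim/nat_ind2: m => [||m IH1 IH2].
- by rewrite /= derivC horner0 !mul0r.
- by rewrite /= derivX hornerC.
rewrite chebSS derivB derivM derivX mul1r !hornerE horner_cheb //.
rewrite mulrBl mulrDl IH1 -mulrA IH2 -[m.+2]addn2 -[m.+1]addn1 !natrD.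
rewrite !addn1 !addn2 !exprS; field.
by rewrite nz_z expf_neq0.
Qed.

Lemma horner_cheb_2e (F : fieldType) m (e : F) : e ^+ 2 = 1 ->
  (cheb F m).[2 * e] = 2 * e ^+ m.
Proof.
move=> e2; elim/nat_ind2: m => [||m IH1 IH2].
- by rewrite /= hornerC mulr1.
- by rewrite /= hornerX.
rewrite chebSS hornerD hornerN hornerM hornerX IH1 IH2 !(exprS e).
move: (e ^+ m) => E.
rewrite [LHS](_ : _ = 2 * E * (2 * e ^+ 2 - 1)); last by ring.
rewrite [RHS](_ : _ = 2 * E * e ^+ 2); last by ring.
by rewrite e2; ring.
Qed.

Lemma horner_deriv_cheb_2e (F : fieldType) m (e : F) : e ^+ 2 = 1 ->
  (cheb F m)^`().[2 * e] = m%:R ^+ 2 * e ^+ m.+1.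
Proof.
move=> e2; elim/nat_ind2: m => [||m IH1 IH2].
- by rewrite /= derivC horner0 expr0n mul0r.
- by rewrite /= derivX hornerC e2 expr1n mul1r.
rewrite chebSS derivB derivM derivX mul1r hornerD hornerN hornerD hornerM hornerX.
rewrite horner_cheb_2e // IH1 IH2.
rewrite -[m.+2]addn2 -[m.+1]addn1 !natrD !addn1 !addn2 !(exprS e).
move: (e ^+ m) => E.
rewrite [LHS](_ : _ = e * E * (2 + 2 * (m%:R + 1) ^+ 2 * e ^+ 2 - m%:R ^+ 2)).
  rewrite [RHS](_ : _ = e * E * ((m%:R + 2) ^+ 2 * e ^+ 2)); last by ring.
  by rewrite e2; ring.
by ring.
Qed.

(** This is Q, and [cyc_prod m] is A: expanding A(x) / x^(m+1) and pairing opposite powers of x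
    gives these terms. *)
Definition ctrace m : {poly algC} := cheb _ m.+1 + cheb _ m - 'X - 2%:P.

Definition cyc_prod m : {poly algC} := ('X^(m.+1) - 1) * ('X^m - 1) * ('X + 1).

Lemma horner_cyc_prod m z :
  (cyc_prod m).[z] = (z ^+ m.+1 - 1) * (z ^+ m - 1) * (z + 1).
Proof. by rewrite /cyc_prod !hornerE. Qed.

Lemma horner_ctrace m z : z != 0 ->
  z ^+ m.+1 * (ctrace m).[z + z^-1] = (cyc_prod m).[z].
Proof.
move=> nz_z; rewrite /ctrace /cyc_prod !hornerE !horner_cheb //.
rewrite !exprS; field.
by rewrite nz_z expf_neq0.
Qed.

Lemma ctrace_monic_size m : (0 < m)%N ->
  ctrace m \is monic /\ size (ctrace m) = m.+2.
Proof.
case: m => // m _; have [mon1 sz1] := cheb_monic_size algC m.+1.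
have [mon2 sz2] := cheb_monic_size algC m.
have lt_sz : (size (cheb algC m.+1 - 'X - 2%:P : {poly algC})%R <
    size (cheb algC m.+2))%N.
  rewrite sz1; rewrite ltnS.
  apply: leq_trans (size_polyD _ _) _; rewrite geq_max size_polyN.
  rewrite (leq_trans (size_polyC_leq1 _)) // andbT.
  apply: leq_trans (size_polyD _ _) _.
  by rewrite geq_max size_polyN size_polyX sz2 leqnn.
have -> : ctrace m.+1 = cheb algC m.+2 + (cheb algC m.+1 - 'X - 2%:P).
  by rewrite !addrA.
rewrite size_polyDl //; split=> //.
by rewrite monicE lead_coefDl // -monicE.
Qed.

Lemma cyc_prod_root_norm m z : (0 < m)%N -> root (cyc_prod m) z -> `|z| = 1.
Proof.
move=> m_gt0; rewrite rootE /cyc_prod !hornerE !mulf_eq0 !subr_eq0 addr_eq0.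
case/orP=> [/orP[]|] /eqP => [zm|zm|->]; last by rewrite normrN1.
  by apply/eqP; rewrite -(@pexpr_eq1 _ _ m.+1) // -normrX zm normr1.
by apply/eqP; rewrite -(@pexpr_eq1 _ _ m) // -normrX zm normr1.
Qed.

(** The derivative is nonzero at every root [r = z + z^-1]. At z = 1 it is (m+1)^2 + m^2 - 1, and at
    z = -1 it is -2(m+1). Otherwise its product with [z - z^-1] is that number times -(m+1) or m,
    according to whether z^(m+1) = 1 or z^m = 1. *)
Lemma ctrace_separable m : odd m -> separable_poly (ctrace m).
Proof.
move=> m_odd; have m_gt0 := odd_gt0 m_odd.
rewrite unlock; apply: Pdiv.ClosedField.root_coprimep => r r_root.
have [z nz_z Dr] := add_inv_surj r.
have Dder x : (ctrace m)^`().[x]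
    = (cheb algC m.+1)^`().[x] + (cheb algC m)^`().[x] - 1.
  by rewrite /ctrace !derivE !hornerE subr0.
have [z2|z2] := eqVneq (z ^+ 2) 1.
  have Dzi : z^-1 = z by apply: (mulfI nz_z); rewrite divff // -expr2.
  rewrite -Dr Dzi -[z + z]mulr2n -mulr_natl Dder !horner_deriv_cheb_2e //.
  rewrite [_ ^+ m.+2]exprS [_ ^+ m.+1]exprS.
  move/eqP: z2; rewrite sqrf_eq1 => /orP[]/eqP->.
    rewrite expr1n !mulr1 -!natrX -natrD subr_eq0 pnatr_eq1.
    by rewrite !expnS; nia.
  rewrite -signr_odd m_odd expr1 -natr1.
  rewrite [X in X != 0](_ : _ = - (2 * m.+1)%:R) ?oppr_eq0 ?pnatr_eq0 //.
  by rewrite natrM -natr1; ring.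
have nz_w : z - z^-1 != 0.
  by rewrite subr_eq0; apply: contra z2 => /eqP Dz; rewrite expr2 {2}Dz divff.
have := horner_ctrace m nz_z; rewrite Dr (rootP r_root) mulr0 /cyc_prod !hornerE.
suffices h: (ctrace m)^`().[r] * (z - z^-1) =
    m.+1%:R * (z ^+ m.+1 - z ^- m.+1) + m%:R * (z ^+ m - z ^- m) - (z - z^-1).
  move/esym/eqP; rewrite !mulf_eq0 !subr_eq0 addr_eq0 => z_root.
  have{z_root} /orP[/eqP zm|/eqP zm]: (z ^+ m.+1 == 1) || (z ^+ m == 1).
  - by case/orP: z_root => // /eqP z1; case/eqP: z2; rewrite z1 sqrrN expr1n.
  - have Dzm : z ^+ m = z^-1 by apply: (mulfI nz_z); rewrite -exprS zm divff.
    move: h; rewrite zm Dzm invr1 subrr mulr0 add0r invrK => h.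
    suffices : (ctrace m)^`().[r] * (z - z^-1) != 0.
      by apply: contra => /eqP->; rewrite mul0r.
    rewrite h [X in X != 0](_ : _ = - (m.+1%:R * (z - z^-1))).
      by rewrite oppr_eq0 mulf_neq0 // pnatr_eq0.
    by rewrite -natr1; ring.
  move: h; rewrite exprS zm mulr1 invr1 subrr mulr0 addr0 => h.
  suffices : (ctrace m)^`().[r] * (z - z^-1) != 0.
    by apply: contra => /eqP->; rewrite mul0r.
  rewrite h [X in X != 0](_ : _ = m%:R * (z - z^-1)).
    by rewrite mulf_neq0 // pnatr_eq0 -lt0n.
  by rewrite -natr1; ring.
by rewrite Dder mulrBl mulrDl mul1r -Dr !horner_deriv_cheb.
Qed.

(** A root is [z + z^-1] with [z] a root of A, so [z] has modulus 1 and the root is twice its real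
    part. *)
Lemma ctrace_roots m : odd m -> exists rs : seq algC,
  [/\ uniq rs, size rs = m.+1, (2 \in rs) && (-2 \in rs),
      {in rs, forall r, r \is Num.real /\ -2 <= r <= 2}
    & ctrace m = \prod_(r <- rs) ('X - r%:P)].
Proof.
move=> m_odd; have m_gt0 := odd_gt0 m_odd.
have [mon sz] := ctrace_monic_size m_gt0.
have [rs Drs] := closed_field_poly_normal (ctrace m).
rewrite (monicP mon) scale1r in Drs.
have in_rs r : (r \in rs) = root (ctrace m) r by rewrite Drs root_prod_XsubC.
exists rs; split=> //.
- have := ctrace_separable m_odd; rewrite Drs -(big_map id xpredT (fun r => 'X - r%:P)).
  by rewrite map_id separable_prod_XsubC.
- by apply: succn_inj; rewrite -sz Drs size_prod_XsubC.
- have e1 : (1 : algC) ^+ 2 = 1 by rewrite expr1n.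
  have eN1 : (-1 : algC) ^+ 2 = 1 by rewrite sqrrN expr1n.
  have ev (e : algC) : e ^+ 2 = 1 ->
      (ctrace m).[2 * e] = 2 * e ^+ m.+1 + 2 * e ^+ m - 2 * e - 2.
    by move=> e2; rewrite /ctrace !hornerE !horner_cheb_2e.
  rewrite !in_rs !rootE -[X in _.[X] == 0]mulr1 -[-2]mulrN1 !ev // !expr1n exprS.
  by apply/andP; split; apply/eqP; ring.
move=> r; rewrite in_rs => r_root; have [z nz_z Dr] := add_inv_surj r.
have z1 : `|z| = 1.
  apply: (cyc_prod_root_norm m_gt0); rewrite rootE -horner_ctrace // Dr.
  by rewrite (rootP r_root) mulr0.
have Dzi : z^-1 = z^* by rewrite invC_norm z1 expr1n invr1 mul1r.
have r_real : r \is Num.real by rewrite CrealE -Dr Dzi rmorphD /= conjCK addrC.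
split=> //; rewrite -real_ler_norml // -Dr Dzi.
by apply: le_trans (ler_normD _ _) _; rewrite norm_conjC z1.
Qed.

(** The order of [algC] is only partial, so the perturbation is carried out in the real closed field
    [algR] and mapped back. *)
Lemma ctrace_perturbed m : odd m -> exists a0 : nat, forall a : nat,
  (a0 <= a)%N -> exists (y0 : algC) (ys : seq algC),
  [/\ y0 \is Num.real /\ 2 < y0,
      {in ys, forall y, y \is Num.real /\ -2 < y < 2}, size ys = m.+1
    & ctrace m * ('X - a%:R%:P) - 1 = \prod_(y <- y0 :: ys) ('X - y%:P)].
Proof.
move=> m_odd; have [rs [Urs sz_rs /andP[rs2 rsN2] rsP Drs]] := ctrace_roots m_odd.
(* Taking the real part makes [toR] total without changing real elements. *)
pose toR (x : algC) : algR := in_algR (Creal_Re x).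
have toRK : {in Num.real, cancel toR algRval} by move=> x /Creal_ReP.
have rs_real r : r \in rs -> r \is Num.real by case/rsP.
pose rs' := [seq toR r | r <- rs].
have Drs' : map algRval rs' = rs.
  rewrite -map_comp map_id_in // => r /rs_real; exact: toRK.
have mem_rs' x : (x \in rs') = (algRval x \in rs).
  by rewrite -Drs' mem_map //; apply: val_inj.
have [|||||a0 a0P] := @perturbed_roots _ rs'.
- by rewrite -(map_inj_uniq val_inj) Drs'.
- by rewrite size_map sz_rs /= m_odd.
- by rewrite mem_rs' rmorph_nat.
- by rewrite mem_rs' rmorphN rmorph_nat.
- move=> x; rewrite mem_rs' => /rsP[_].
  by rewrite -[2 in X in X -> _](rmorph_nat algRval) -rmorphN.
have /archi_boundP lt_a0 : 0 <= `|a0| by [].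
exists (Num.bound `|a0|) => a le_a.
have [|y0 [ys [y0_gt2 ysP sz_ys Dys]]] := a0P a%:R.
  apply: le_trans (ler_norm _) _; apply: le_trans (ltW lt_a0) _.
  by rewrite ler_nat.
exists (algRval y0), (map algRval ys); split.
- by rewrite (algRvalP y0) -(rmorph_nat algRval).
- move=> _ /mapP[y /ysP y_lt2 ->]; rewrite (algRvalP y).
  by rewrite -(rmorph_nat algRval) -rmorphN.
- by rewrite size_map sz_ys size_map.
have mapE s : map_poly algRval (\prod_(y <- s) ('X - y%:P))
    = \prod_(y <- map algRval s) ('X - y%:P).
  rewrite rmorph_prod big_map; apply: eq_bigr => y _.
  by rewrite /= map_polyXsubC.
have := congr1 (map_poly algRval) Dys.
rewrite rmorphB rmorphM /= !mapE rmorph1 map_polyXsubC Drs' -Drs => <-.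
by rewrite (rmorph_nat algRval).
Qed.

(** * The polynomial [S] and its root [al] *)

(** This lifts the linear factor at [y] along x + 1/x: for nonzero x its value is x (x + 1/x -
    y). *)
Definition quad (y : algC) : {poly algC} := 'X^2 - y *: 'X + 1.

Lemma hornerE_quad y z : (quad y).[z] = z ^+ 2 - y * z + 1.
Proof. by rewrite /quad !hornerE. Qed.

Lemma horner_quad y z : z != 0 -> (quad y).[z] = z * (z + z^-1 - y).
Proof. by move=> nz_z; rewrite hornerE_quad; field; rewrite nz_z. Qed.

Lemma quad_add_inv z : z != 0 ->
  quad (z + z^-1) = ('X - z%:P) * ('X - z^-1%:P).
Proof.
move=> nz_z; rewrite /quad -mul_polyC rmorphD /=.
have <- : z%:P * z^-1%:P = 1 :> {poly algC} by rewrite -rmorphM /= divff.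
by ring.
Qed.

Lemma root_quad y z : root (quad y) z = (z != 0) && (z + z^-1 == y).
Proof.
have [->|nz_z] := eqVneq z 0.
  by rewrite rootE hornerE_quad expr0n mulr0 subr0 add0r oner_eq0.
by rewrite rootE horner_quad // mulf_eq0 (negPf nz_z) subr_eq0.
Qed.

Lemma quad_monic_size y : quad y \is monic /\ size (quad y) = 3.
Proof.
have [z nz_z <-] := add_inv_surj y; rewrite quad_add_inv //; split.
  by rewrite rpredM ?monicXsubC.
by rewrite size_Mmonic ?monicXsubC ?monic_neq0 ?monicXsubC // !size_XsubC.
Qed.

Lemma prod_quad_monic_size (ys : seq algC) :
  \prod_(y <- ys) quad y \is monic
  /\ size (\prod_(y <- ys) quad y) = (size ys).*2.+1.
Proof.
elim: ys => [|y ys [mon sz]]; first by rewrite big_nil monic1 size_poly1.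
have [mon1 sz1] := quad_monic_size y; rewrite big_cons rpredM //; split=> //.
by rewrite size_Mmonic ?monic_neq0 // sz sz1 /=.
Qed.

(** This form of S, rather than x^(m+2) T(x + 1/x), makes the integrality of the coefficients
    visible. *)
Definition spoly m (a : nat) : {poly algC} :=
  quad a%:R * cyc_prod m - 'X^(m.+2).

Lemma horner_spoly m a z :
  (spoly m a).[z] = (quad a%:R).[z] * (cyc_prod m).[z] - z ^+ m.+2.
Proof. by rewrite {1}/spoly hornerD hornerN hornerM hornerXn. Qed.

(** Both sides agree at every point: at 0 both are 1, and elsewhere both are z^(m+2) T(z + 1/z). *)
Lemma spoly_factor m (a : nat) (ys : seq algC) : (0 < m)%N ->
    ctrace m * ('X - a%:R%:P) - 1 = \prod_(y <- ys) ('X - y%:P) ->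
    size ys = m.+2 ->
  spoly m a = \prod_(y <- ys) quad y.
Proof.
move=> m_gt0 Dys sz_ys; apply/eqP; rewrite -subr_eq0; apply/idPn.
case/closed_nonrootP=> z; rewrite rootE hornerD hornerN horner_prod subr_eq0.
rewrite horner_spoly => /eqP[].
have [->|nz_z] := eqVneq z 0.
  rewrite hornerE_quad /cyc_prod !hornerE !expr0n /= eqn0Ngt m_gt0 /=.
  by rewrite big1 => [|y _]; rewrite ?hornerE_quad ?expr0n /=; ring.
under eq_bigr => y _ do rewrite horner_quad //.
rewrite big_split /= big_const_seq count_predT iter_mulr_1 sz_ys.
have -> : \prod_(y <- ys) (z + z^-1 - y)
    = (ctrace m).[z + z^-1] * (z + z^-1 - a%:R) - 1.
  have := congr1 (fun p => p.[z + z^-1]) Dys.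
  rewrite horner_prod hornerD hornerN hornerM hornerXsubC -polyC1 hornerC => ->.
  by apply: eq_bigr => y _; rewrite !hornerE.
rewrite -horner_ctrace // horner_quad // (exprS z m.+1).
by move: (z ^+ m.+1) => w; ring.
Qed.

Lemma spoly_int m a : spoly m a \is a polyOver Num.int.
Proof.
(* The underlying predicate of [Num.int] is exposed for the closure lemmas used below. *)
change (spoly m a \is a polyOver Num.int_num_subdef).
have aX : (a%:R *: 'X : {poly algC}) \is a polyOver Num.int_num_subdef.
  by rewrite polyOverZ ?polyOverX // rpred_nat.
have Xn k : ('X^k : {poly algC}) \is a polyOver Num.int_num_subdef.
  by rewrite polyOverXn.
have quad_int : quad a%:R \is a polyOver Num.int_num_subdef.
  by rewrite rpredD ?rpred1 // rpredB.
rewrite rpredB // rpredM // rpredM //; last by rewrite rpredD ?rpred1 // polyOverX.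
by rewrite rpredM // rpredB ?rpred1.
Qed.

(** * Integral polynomials and integer units *)

(** Division by a monic polynomial stays within [{poly int}]; the remainder is shorter than [q] yet
    divisible by it, hence zero. *)
Lemma dvdp_monic_int (p q : {poly algC}) :
    p \is a polyOver Num.int -> q \is a polyOver Num.int -> q \is monic ->
    q %| p ->
  exists2 g, g \is a polyOver Num.int & p = g * q.
Proof.
pose f := map_poly (intr : int -> algC).
have f_int r : f r \is a polyOver Num.int.
  by apply/polyOverP=> i; rewrite coef_map /= intr_int.
move=> /floorpP[pz ->] /floorpP[qz Dq]; rewrite Dq -/(f pz) -/(f qz) => mon_q dvd_q.
have mon_qz : qz \is monic.
  move: mon_q; rewrite !monicE /f lead_coef_map_inj //.
    by rewrite -(eqr_int algC _ 1).
  exact: intr_inj.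
have Dp := Pdiv.RingMonic.rdivp_eq mon_qz pz.
set g := Pdiv.Ring.rdivp pz qz in Dp; set r := Pdiv.Ring.rmodp pz qz in Dp.
have Dfp : f pz = f g * f qz + f r by rewrite Dp /f rmorphD rmorphM.
exists (f g) => //; rewrite Dfp.
suffices -> : f r = 0 by rewrite addr0.
have sz_f (h : {poly int}) : size (f h) = size h.
  by rewrite size_map_inj_poly //; exact: (@intr_inj algC).
apply/eqP; apply: contraT => nz_r.
have : (size r < size qz)%N by rewrite Pdiv.Ring.ltn_rmodp monic_neq0.
rewrite ltnNge -(sz_f qz) -(sz_f r) dvdp_leq //.
by move: dvd_q; rewrite Dfp dvdp_addr // dvdp_mull.
Qed.

Lemma minCpoly_dvdp x (p : {poly algC}) : p \is a polyOver Num.int -> root p x ->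
  minCpoly x %| p.
Proof.
move=> /floorpP[pz ->]; have [q [-> _] dvd_q] := minCpolyP x.
have -> : map_poly intr pz = map_poly (ratr : rat -> algC) (map_poly intr pz).
  by rewrite -map_poly_comp; apply: eq_map_poly => b; rewrite /= rmorph_int.
by rewrite dvd_q dvdp_map.
Qed.

(* Modulo [x^2 - a x + 1] an integral polynomial reduces to [u x + v], so the
   product below is the integer [u^2 + u v a + v^2]. *)
Lemma horner_inv_pair_int (p : {poly algC}) (b : algC) : b != 0 ->
    b + b^-1 \in Num.int -> p \is a polyOver Num.int ->
  p.[b] * p.[b^-1] \in Num.int.
Proof.
move=> nz_b; have [a Da] : {a | a = b + b^-1} by exists (b + b^-1).
rewrite -Da => a_int p_int.
suffices [u [v [u_int v_int ub vb]]] : exists u v,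
    [/\ u \in Num.int, v \in Num.int, p.[b] = u * b + v & p.[b^-1] = u * b^-1 + v].
  rewrite ub vb [X in X \in _](_ : _ = u ^+ 2 + u * v * a + v ^+ 2).
    by rewrite !(rpredD, rpredM, rpredX).
  by rewrite Da; field; rewrite nz_b.
elim/poly_ind: p p_int => [_|p c IHp pc_int].
  by exists 0, 0; rewrite !horner0 !mul0r addr0 rpred0.
have [|u [v [u_int v_int ub vb]]] := IHp.
  apply/polyOverP=> i; have := polyOverP pc_int i.+1.
  by rewrite coefD coefMX coefC /= addr0.
exists (u * a + v), (c - u); split.
- by rewrite rpredD ?rpredM.
- rewrite rpredB //; have := polyOverP pc_int 0%N.
  by rewrite coefD coefMX coefC /= add0r.
- by rewrite hornerD hornerMX hornerC ub Da; field; rewrite nz_b.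
by rewrite hornerD hornerMX hornerC vb Da; field; rewrite nz_b.
Qed.

Lemma int_unit_norm (x y : algC) : x \in Num.int -> y \in Num.int ->
  x * y = 1 -> `|x| = 1.
Proof.
move=> x_int y_int xy1.
have /andP[nz_x nz_y] : (x != 0) && (y != 0) by rewrite -negb_or -mulf_eq0 xy1 oner_neq0.
have x_ge1 := norm_intr_ge1 x_int nz_x; have y_ge1 := norm_intr_ge1 y_int nz_y.
apply: le_anti; rewrite x_ge1 andbT -(normr1 algC) -xy1 normrM.
by rewrite ler_peMr.
Qed.

Lemma prod_gt1 (T : eqType) (s : seq T) (F : T -> algC) z :
    {in s, forall x, 1 <= F x} -> z \in s -> 1 < F z ->
  1 < \prod_(x <- s) F x.
Proof.
move=> F_ge1 s_z Fz_gt1; rewrite (big_rem z) //=.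
suffices le1 : 1 <= \prod_(x <- rem z s) F x.
  apply: lt_le_trans Fz_gt1 _; rewrite ler_peMr //.
  by rewrite (le_trans ler01) ?F_ge1.
rewrite big_seq; apply: (big_ind (fun x => 1 <= x)) => //.
  exact: mulr_ege1.
by move=> x /mem_rem/F_ge1.
Qed.

(** * Solutions of z + 1/z = y for real y *)

(** The conjugate of [z] has the same real value of z + 1/z, so it is [z] or [z^-1]. *)
Lemma add_inv_conj (z : algC) : z != 0 -> z + z^-1 \is Num.real ->
  z \is Num.real \/ `|z| = 1.
Proof.
move=> nz_z /CrealP; rewrite rmorphD /= fmorphV => eq_z.
have nz_zc : z^* != 0 by rewrite conjC_eq0.
have [/CrealP|zc] := add_inv_inj nz_zc nz_z eq_z; [by left|right].
apply/eqP; rewrite -(@pexpr_eq1 _ _ 2) // normCK zc divff //.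
Qed.

(** For real [z] the positive number 4 - y^2 would equal -(z - 1/z)^2. *)
Lemma add_inv_unit_circle (z y : algC) : z != 0 -> y \is Num.real ->
  -2 < y < 2 -> z + z^-1 = y -> `|z| = 1.
Proof.
move=> nz_z y_real /andP[y_gt y_lt] Dy.
have [|z_real|//] := @add_inv_conj z nz_z; first by rewrite Dy.
have: 0 < (2 - y) * (y + 2) by rewrite mulr_gt0 ?subr_gt0 // -[2]opprK subr_gt0.
rewrite (_ : _ * _ = - (z - z^-1) ^+ 2); last by rewrite -Dy; field; rewrite nz_z.
by rewrite oppr_gt0 real_ltNge ?real_exprn_even_ge0 ?rpredX ?rpredB ?rpredV.
Qed.

(** A solution of modulus 1 would force [y <= 2]. So [z] is real, and positive like [y]; replacing
    it by its inverse if necessary makes it exceed 1. *)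
Lemma add_inv_gt1 (y : algC) : y \is Num.real -> 2 < y ->
  exists z, [/\ z \is Num.real, 1 < z & z + z^-1 = y].
Proof.
move=> y_real y_gt2; have [z nz_z Dy] := add_inv_surj y.
have z_real : z \is Num.real.
  have [|//|z1] := @add_inv_conj z nz_z; first by rewrite Dy.
  have: `|y| <= 2.
    by rewrite -Dy; apply: le_trans (ler_normD _ _) _; rewrite normfV z1 invr1.
  by rewrite ger0_norm ?(le_trans _ (ltW y_gt2)) // real_leNgt // ?y_gt2 ?realn.
have z_gt0 : 0 < z.
  rewrite real_ltNge ?real0 //; apply/negP=> z_le0.
  have: y <= 0 by rewrite -Dy -[0]addr0 lerD // invr_le0.
  by move/(lt_le_trans y_gt2); rewrite ltrn0.
have [z_lt1|z_gt1|z1] := real_ltgtP z_real (real1 algC).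
- by exists z^-1; rewrite rpredV z_real invf_gt1 ?z_lt1 // invrK addrC.
- by exists z.
by move: y_gt2; rewrite -Dy z1 invr1 ltxx.
Qed.

(** * Irreducibility of S and the Salem property *)

Lemma monic_prod_roots (p : {poly algC}) : p \is monic ->
  {rs : seq algC | p = \prod_(z <- rs) ('X - z%:P)}.
Proof.
move=> mon; have [rs Dp] := closed_field_poly_normal p.
by exists rs; rewrite {1}Dp (monicP mon) scale1r.
Qed.

(** The roots other than [al] and [al^-1] come from [ys] and lie on the unit circle; nonemptiness of
    [ys] supplies the required conjugate there. The proof shows that S is the minimal polynomial of
    [al]. *)
Lemma spoly_salem m (a : nat) (y0 : algC) (ys : seq algC) :
    (0 < m)%N -> (3 < a)%N -> y0 \is Num.real -> 2 < y0 ->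
    {in ys, forall y, y \is Num.real /\ -2 < y < 2} -> (0 < size ys)%N ->
    spoly m a = \prod_(y <- y0 :: ys) quad y ->
  exists al, [/\ salem al, alg_degree al = (size ys).+1.*2,
    root (spoly m a) al & al^-1 \in Aint].
Proof.
move=> m_gt0 a_gt3 y0_real y0_gt2 ysP ys_gt0 DS.
have [al [al_real al_gt1 Dy0]] := add_inv_gt1 y0_real y0_gt2.
have al_gt0 : 0 < al by rewrite (lt_trans ltr01).
have nz_al : al != 0 by rewrite gt_eqF.
have [S_monic szS] := prod_quad_monic_size (y0 :: ys); rewrite -DS in S_monic szS.
set W := \prod_(y <- ys) quad y.
have DSW : spoly m a = ('X - al%:P) * ('X - al^-1%:P) * W.
  by rewrite DS big_cons -Dy0 quad_add_inv.
have S_al : root (spoly m a) al by rewrite DSW -mulrA rootM root_XsubC eqxx.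
have S_ali : root (spoly m a) al^-1.
  by rewrite DSW mulrAC rootM [X in _ || X]root_XsubC eqxx orbT.
have W_root z : root W z -> `|z| = 1.
  rewrite /W rootE horner_prod => /eqP/eqP; rewrite prodf_seq_eq0.
  case/hasP=> y /ysP[y_real y_lt2] /=; rewrite -/(root _ z) root_quad.
  by case/andP=> nz_z /eqP; apply: add_inv_unit_circle.
have S_root z : root (spoly m a) z -> [|| z == al, z == al^-1 | `|z| == 1].
  rewrite DSW !rootM !root_XsubC -orbA.
  by case/or3P=> [->|->|/W_root->]; rewrite ?eqxx ?orbT.
have ali_lt1 : al^-1 < 1 by rewrite invf_lt1.
have norm_al : `|al| = al by rewrite ger0_norm ?ltW.
have norm_ali : `|al^-1| = al^-1 by rewrite normfV norm_al.
have W_al : ~~ root W al.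
  by apply/negP=> /W_root /eqP; rewrite norm_al gt_eqF.
have W_ali : ~~ root W al^-1.
  by apply/negP=> /W_root /eqP; rewrite norm_ali lt_eqF.
have ne_ali : al != al^-1 by rewrite gt_eqF // (lt_trans ali_lt1).
set P := minCpoly al.
have P_al : root P al := root_minCpoly al.
have al_int : al \in Aint := root_monic_Aint S_al S_monic (spoly_int m a).
have P_monic : P \is monic := minCpoly_monic al.
have P_int : P \is a polyOver Num.int := al_int.
have [g g_int DSg] : exists2 g, g \is a polyOver Num.int & spoly m a = g * P.
  by apply: dvdp_monic_int (minCpoly_dvdp _ S_al) => //; apply: spoly_int.
have g_monic : g \is monic by rewrite -(monicMr _ P_monic) -DSg.
(* Both [al] and [al^-1] are simple roots of S, so neither can be shared by [P] and its cofactor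
   [g]. *)
have simple_root z w : ('X - z%:P) * ('X - w%:P) * W = g * P -> z != w ->
    ~~ root W z -> root P z -> ~~ root g z.
  move=> eq_gP ne_zw nWz /factor_theorem[P1 DP1]; apply/negP=> gz.
  have: ('X - w%:P) * W = g * P1.
    apply: (mulfI (monic_neq0 (monicXsubC z))); rewrite mulrA eq_gP DP1; ring.
  move/(congr1 (root^~ z)); rewrite !rootM root_XsubC (negPf ne_zw).
  by rewrite (negPf nWz) gz.
have g_al : ~~ root g al by apply: (simple_root al al^-1) => //; rewrite -DSW.
have [gs Dg] := monic_prod_roots g_monic.
have [ps DP] := monic_prod_roots P_monic.
have gs_S z : z \in gs -> root (spoly m a) z.
  by move=> gs_z; rewrite DSg rootM Dg root_prod_XsubC gs_z.
have ps_S z : z \in ps -> root (spoly m a) z.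
  by move=> ps_z; rewrite DSg rootM DP root_prod_XsubC ps_z orbT.
have S0 : (spoly m a).[0] = 1.
  by rewrite DS horner_prod big1 // => y _; rewrite hornerE_quad mulr0 expr0n subr0 add0r.
have horner0_int p : p \is a polyOver Num.int -> p.[0] \in Num.int.
  by move/polyOverP=> p_int; rewrite horner_coef0.
(* Otherwise all roots of P other than al have modulus 1, whereas P(0) is a
   unit. *)
have P_ali : root P al^-1.
  apply/idPn=> nP_ali; have := @int_unit_norm P.[0] g.[0].
  rewrite mulrC -hornerM -DSg S0 !horner0_int // => /(_ isT isT erefl) /eqP.
  apply/negP; rewrite gt_eqF // DP horner_prod normr_prod.
  apply: (@prod_gt1 _ _ _ al) => [z ps_z||]; rewrite ?hornerXsubC ?sub0r ?normrN.
  - have /or3P[/eqP->|/eqP Dz|/eqP->//] := S_root z (ps_S z ps_z).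
      by rewrite norm_al ltW.
    by case/negP: nP_ali; rewrite DP root_prod_XsubC -Dz.
  - by rewrite -root_prod_XsubC -DP.
  - by rewrite norm_al.
have g_ali : ~~ root g al^-1.
  by apply: (simple_root al^-1 al); rewrite 1?eq_sym // [X in X * _]mulrC -DSW.
have gs_norm z : z \in gs -> `|z| = 1.
  move=> gs_z; have /or3P[/eqP Dz|/eqP Dz|/eqP//] := S_root z (gs_S z gs_z).
    by case/negP: g_al; rewrite Dg root_prod_XsubC -Dz.
  by case/negP: g_ali; rewrite Dg root_prod_XsubC -Dz.
have g1 : gs = [::].
  case Dgs: {1}gs => [//|z0 gs1].
  have gs_z0 : z0 \in gs by rewrite Dgs mem_head.
  have [b nz_b Db] := add_inv_surj a%:R.
  have ab_int : b + b^-1 \in Num.int by rewrite Db rpred_nat.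
  have quad_b : (quad a%:R).[b] = 0 by rewrite horner_quad // Db subrr mulr0.
  have quad_bi : (quad a%:R).[b^-1] = 0.
    by rewrite horner_quad ?invr_eq0 // invrK [_ + b]addrC Db subrr mulr0.
  (* Since [quad a%:R] vanishes at [b] and [b^-1], S(b) S(1/b) = 1. This is a product of two
     integers, one from [g] and one from [P], so the one from [g] has modulus 1. *)
  have := int_unit_norm (horner_inv_pair_int nz_b ab_int g_int)
    (horner_inv_pair_int nz_b ab_int P_int).
  rewrite mulrACA -!hornerM -DSg !horner_spoly.
  rewrite quad_b quad_bi !mul0r !sub0r mulrNN -exprMn divff // expr1n.
  move=> /(_ erefl) /eqP; case/negP; rewrite gt_eqF // Dg !horner_prod.
  rewrite -big_split normr_prod /=.
  have big_dist z : z \in gs -> 1 < `|('X - z%:P).[b] * ('X - z%:P).[b^-1]|.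
    move=> gs_z; have z1 := gs_norm z gs_z.
    have nz_z : z != 0 by rewrite -normr_eq0 z1 oner_neq0.
    rewrite !hornerXsubC.
    (* The product is z^2 - a z + 1; on the unit circle its modulus is at least a - 2, which exceeds
       1 because [3 < a]. *)
    have -> : (b - z) * (b^-1 - z) = - z * (a%:R - (z + z^-1)).
      by rewrite -Db; field; rewrite nz_b nz_z.
    rewrite normrM normrN z1 mul1r.
    apply: lt_le_trans (lerB_dist _ _).
    rewrite normr_nat ltrBrDl.
    apply: le_lt_trans (_ : 3%:R < _); last by rewrite ltr_nat.
    rewrite (natrD _ 2 1) lerD2r; apply: le_trans (ler_normD _ _) _.
    by rewrite normfV z1 invr1.
  apply: (@prod_gt1 _ _ _ z0) => [z /big_dist/ltW||] //; exact: big_dist.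
have DPS : P = spoly m a by rewrite DSg Dg g1 big_nil mul1r.
exists al; split=> //; first last.
- exact: root_monic_Aint S_ali S_monic (spoly_int m a).
- by rewrite /alg_degree -/P DPS szS.
split=> //.
  move=> z; rewrite /conjugate -/P DPS => /S_root/or3P[->//|/eqP->|/eqP->//] _.
  by rewrite norm_ali ltW.
case Dys: ys ys_gt0 => [//|y1 ys1] _.
have ys_y1 : y1 \in ys by rewrite Dys mem_head.
have [z nz_z Dz] := add_inv_surj y1; have [y1_real y1_lt2] := ysP y1 ys_y1.
exists z; last exact: add_inv_unit_circle Dz.
rewrite /conjugate -/P DPS DSW rootM; apply/orP; right.
rewrite /W (big_rem y1) //= rootM root_quad nz_z Dz eqxx //.
Qed.

(** * Distinctness of the roots, units, and conclusion *)

(** At a nonzero root A cannot vanish, so the equation S = 0 determines [a]. Hence different values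
    of [a] yield different Salem numbers. *)
Lemma spoly_root_inj m (a b : nat) (al : algC) : al != 0 ->
  root (spoly m a) al -> root (spoly m b) al -> a = b.
Proof.
move=> nz_al; rewrite !rootE !horner_spoly !subr_eq0 => /eqP Sa /eqP Sb.
apply/eqP; rewrite -(eqr_nat algC); apply/eqP.
have nzS : (quad a%:R).[al] * (cyc_prod m).[al] != 0 by rewrite Sa expf_neq0.
have nzA : (cyc_prod m).[al] != 0.
  by apply: contraNneq nzS => ->; rewrite mulr0.
have: (quad a%:R).[al] = (quad b%:R).[al] by apply: (mulIf nzA); rewrite Sa Sb.
by rewrite !horner_quad // => /(mulfI nz_al)/addrI/oppr_inj.
Qed.

Lemma spoly_root_unit m (a n : nat) (al : algC) :
    al \in Aint -> al != 0 -> al^-1 \in Aint -> root (spoly m a) al ->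
    (n %| m.+1)%N ->
  alg_unit (al ^+ n - 1).
Proof.
move=> al_int nz_al ali_int; rewrite rootE horner_spoly subr_eq0 => /eqP S_al.
case/dvdnP=> k Dk; set x := al ^+ n - 1.
have x_int : x \in Aint by rewrite rpredB ?rpredX ?rpred1.
(* This is the cofactor of [x] in A(al): the geometric sum is the quotient of al^(m+1) - 1 by al^n -
   1. *)
pose w := (\sum_(i < k) (al ^+ n) ^+ i) * (al ^+ m - 1) * (al + 1).
have w_int : w \in Aint.
  rewrite !rpredM ?rpredB ?rpredD ?rpredX ?rpred1 // rpred_sum // => i _.
  by rewrite !rpredX.
have Dw : (cyc_prod m).[al] = x * w.
  by rewrite horner_cyc_prod Dk mulnC exprM subrX1 /w !mulrA.
clearbody w x.
have xV : x * (w * (quad a%:R).[al] * al^-1 ^+ m.+2) = 1.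
  rewrite [x * _]mulrA [x * (w * _)]mulrA -Dw [_ * (quad _).[_]]mulrC.
  by rewrite S_al exprVn divff ?expf_neq0.
have nz_x : x != 0 by apply: contra_eq_neq xV => ->; rewrite mul0r eq_sym oner_neq0.
split=> //; have -> : x^-1 = w * (quad a%:R).[al] * al^-1 ^+ m.+2.
  by apply: (mulfI nz_x); rewrite xV divff.
rewrite rpredM ?rpredX // rpredM // hornerE_quad.
by rewrite rpredD ?rpred1 // rpredB ?rpredX // rpredM // rpred_nat.
Qed.

Lemma infinite_set_inj (T : Type) (A : set T) (f : nat -> T) :
  injective f -> (forall n, A (f n)) -> infinite_set A.
Proof.
move=> f_inj fA finA; apply: infinite_nat.
have: finite_set (range f) by apply: sub_finite_set finA => _ [n _ <-].
by rewrite (eq_finite_set (inj_card_eq _)) // => x y _ _ /f_inj.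
Qed.

Theorem mainTheorem4 (F : set nat) (Ffin : finite_set F)
    (Fpos : forall n, F n -> (0 < n)%N) :
  exists N : set nat,
    [/\ infinite_set N,
        (forall d, N d -> (0 < d)%N /\ ~~ odd d)
      & forall d, N d ->
          infinite_set [set a : algC | [/\ salem a, alg_degree a = d
            & forall n, F n -> alg_unit (a ^+ n - 1)]]].
Proof.
have [s Ds] := (finite_seqP F).1 Ffin.
have s_gt0 n : n \in s -> (0 < n)%N by move=> s_n; apply: Fpos; rewrite Ds.
pose M := (\prod_(n <- s) n)%N.
have M_gt0 : (0 < M)%N.
  by rewrite /M big_seq; apply: prodn_cond_gt0 => n /s_gt0.
have dvd_M n : F n -> (n %| M)%N.
  by rewrite Ds /= /M => s_n; rewrite (big_rem n) //= dvdn_mulr.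
(* Here m + 1 is an even multiple of the common multiple [M] of the elements of [F], so m is odd;
   the predecessor is not truncated because [M] is positive. *)
pose m j := (2 * (M * j.+1)).-1.
have mS j : (m j).+1 = (2 * (M * j.+1))%N by rewrite prednK // !muln_gt0 M_gt0.
have m_odd j : odd (m j) by have := mS j; lia.
exists (range (fun j => (m j).+2.*2)); split.
- apply: (@infinite_set_inj _ _ (fun j => (m j).+2.*2)) => [i j|j]; last by exists j.
  have := mS i; have := mS j; nia.
- by move=> _ [j _ <-]; rewrite odd_double.
move=> _ [j _ <-]; have m_gt0 := odd_gt0 (m_odd j).
have [a0 a0P] := ctrace_perturbed (m_odd j).
(* The offset [a0 + 4] meets both the perturbation bound and the requirement [3 < a], while [k]
   ranges over infinitely many choices. *)
have salem_ex k : exists al, [/\ salem al, alg_degree al = (m j).+2.*2,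
    root (spoly (m j) (a0 + 4 + k)) al & al^-1 \in Aint].
  have [|y0 [ys [[y0_real y0_gt2] ysP sz_ys Dys]]] := a0P (a0 + 4 + k)%N; first by lia.
  rewrite -sz_ys; apply: (@spoly_salem _ _ y0) => //; first by lia.
    by rewrite sz_ys.
  by apply: spoly_factor => //=; rewrite sz_ys.
have [f fP] := choice salem_ex.
have nz_f k : f k != 0.
  by have [[_ _ f_gt1 _ _] _ _ _] := fP k; rewrite gt_eqF // (lt_trans ltr01).
apply: (@infinite_set_inj _ _ f) => [k l eq_f|k].
  have [_ _ Sk _] := fP k; have [_ _ Sl _] := fP l; rewrite -eq_f in Sl.
  by have := spoly_root_inj (nz_f k) Sk Sl; lia.
have [al_salem al_deg S_al ali_int] := fP k; split=> // n Fn.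
case: (al_salem) => al_int _ _ _ _.
apply: spoly_root_unit S_al _ => //.
by rewrite mS dvdn_mull // dvdn_mulr // dvd_M.
Qed.
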